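(* Let $G$ and $H$ be finite simple graphs with $n$ and $m$ vertices respectively ($n,m\ge 1$, disjoint vertex sets). Then $B'(G+H)=B(G+H)=\min\{B'(G),B'(H),a\}$, where $a=\gamma(G)+\gamma(H)$ if $n=1$ or $m=1$ or $\gamma(G)=\gamma(H)=1$; $a=3$ if $n\ge 2$, $m\ge 2$, and ($\gamma(G)\le 2$ or $\gamma(H)\le 2$) but not $\gamma(G)=\gamma(H)=1$; $a=4$ if $\gamma(G)\ge 3$ and $\gamma(H)\ge 3$.
   Context: The join $G+H$ has vertex set $V(G)\cup V(H)$ and edge set $E(G)\cup E(H)\cup\{xy:x\in V(G),y\in V(H)\}$. $\gamma(G)$ is the domination number of $G$ (minimum size of a set $D$ such that every vertex is in $D$ or adjacent to a vertex of $D$). In a graph each vertex is black or white; in the zero forcing process, if a black vertex has exactly one white neighbor $w$, then $w$ becomes black, iterated. A set $S$ of initially black vertices is a failed zero forcing set if the process does not make all vertices black, and then $V(G)\setminus S$ is a zero blocking set. $B(G)$ is the minimum size of a zero blocking set of $G$; $B'(G)$ is the minimum size of a zero blocking set of size at least two, with $B'(G)=\infty$ if none exists (e.g. when $G$ has one vertex).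
   Formalization: B' is taken over zero blocking sets of size at least two all of whose vertices stay white (no force possible); with arbitrary zero blocking sets the formula fails for graphs with an isolated vertex, e.g. G = K_1 ∪ P_4, H = K_1, where B'(G) = 2 but B(G+H) = 3. *)

(* Defs.v *)
From HB Require Import structures.
From mathcomp Require Import all_boot.

Set Implicit Arguments.
Unset Strict Implicit.
Unset Printing Implicit Defensive.

Record sgraph := SGraph {
  vertex :> finType;
  adj : rel vertex;
  adj_sym : symmetric adj;
  adj_irrefl : irreflexive adj }.

Section Join.
Variables G H : sgraph.

Definition join_adj : rel (G + H)%type := fun x y =>
  match x, y with
  | inl u, inl v => adj u v
  | inr u, inr v => adj u v
  | _, _ => true
  end.

Lemma join_adj_sym : symmetric join_adj.
Proof. by move=> [x|x] [y|y] //=; rewrite adj_sym. Qed.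

Lemma join_adj_irrefl : irreflexive join_adj.
Proof. by move=> [x|x] /=; rewrite adj_irrefl. Qed.

Definition join : sgraph := SGraph join_adj_sym join_adj_irrefl.
End Join.

(* Natural numbers extended by infinity, which is represented by None. *)
Definition omin (x y : option nat) : option nat :=
  match x, y with
  | Some a, Some b => Some (minn a b)
  | None, _ => y
  | _, None => x
  end.

Lemma ominA : associative omin.
Proof. by move=> [a|] [b|] [c|] //=; rewrite minnA. Qed.

Lemma ominC : commutative omin.
Proof. by move=> [a|] [b|] //=; rewrite minnC. Qed.

Lemma omin0 : left_id None omin.
Proof. by case. Qed.

HB.instance Definition _ := Monoid.isComLaw.Build _ None omin ominA ominC omin0.

(* None when no set satisfies P. *)
Definition min_size (T : finType) (P : pred {set T}) : option nat :=
  \big[omin/None]_(A : {set T} | P A) Some #|A|.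

Section Invariants.
Variable G : sgraph.
Implicit Types (D S Z : {set G}) (v w : G).

Definition dominating D : bool :=
  [forall v, (v \in D) || [exists u in D, adj v u]].

(* The whole vertex set is dominating, so the minimum is over a nonempty
   family. *)
Definition domination_number : nat :=
  #|[arg min_(D < [set: G] | dominating D) #|D| ]|.

Definition white_neighbors S v : {set G} := [set w | adj v w & w \notin S].

(* One round: every black vertex with exactly one white neighbor forces it. *)
Definition force_round S : {set G} :=
  S :|: [set w | [exists v in S, white_neighbors S v == [set w]]].

(* The final set of black vertices: by force_process_max below, #|G| rounds
   suffice. *)
Definition force_process S : {set G} := iter #|G| force_round S.

Definition failed_zero_forcing S : bool := force_process S != [set: G].

Definition zero_blocking Z : bool := failed_zero_forcing (~: Z).

Definition stalled S : bool := force_round S == S.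

Definition B : option nat := min_size zero_blocking.

(* The minimum runs over the zero blocking sets whose complement is stalled,
   i.e. whose vertices all remain white. Without this restriction an isolated
   vertex v would make every pair {v, w} count, although only v blocks
   anything, and the formula for joins would fail: for G the disjoint union of
   K_1 and P_4, and H = K_1, the minimum for G would be 2 while
   B (join G H) = 3. Dropping the restriction does not change the value for
   graphs without isolated vertices, and imposing it in B would not change B. *)
Definition B' : option nat :=
  min_size [pred Z | [&& zero_blocking Z, stalled (~: Z) & 2 <= #|Z|]].

Lemma force_process_stalled S : stalled (force_process S).
Proof.
have sub k : iter k force_round S \subset iter k.+1 force_round S.
  by rewrite iterS subsetUl.
have grow k : stalled (iter k force_round S) || (k <= #|iter k force_round S|).
  elim: k => [|k /orP[st|le_k]]; first by rewrite orbT.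
    by rewrite iterS (eqP st) st.
  case: (boolP (stalled (iter k force_round S))) => [st|nst].
    by rewrite iterS (eqP st) st.
  apply/orP; right; apply: leq_ltn_trans le_k _; apply: proper_card.
  by rewrite properEneq sub andbT eq_sym.
have /orP[//|le_n] := grow #|G|.
have fullE : force_process S = [set: G].
  by apply/eqP; rewrite eqEcard subsetT cardsT.
by rewrite /stalled fullE /force_round setTU.
Qed.

Lemma force_process_max S k : iter k force_round S \subset force_process S.
Proof.
have mono i j : i <= j -> iter i force_round S \subset iter j force_round S.
  move=> /subnK <-; elim: (j - i) => [|d IH] //=.
  exact: subset_trans IH (subsetUl _ _).
case: (leqP k #|G|) => [/mono //|/ltnW le_k].
rewrite -(subnK le_k) iterD -/(force_process S).
elim: (k - #|G|) => [|d IH] //=.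
suff -> : iter d force_round (force_process S) = force_process S.
  by rewrite (eqP (force_process_stalled S)).
by elim: d {IH} => //= d ->; apply/eqP/force_process_stalled.
Qed.
End Invariants.

(* The last case is the one with both domination numbers at least 3, which
   already forces both graphs to have at least two vertices. *)
Definition join_constant (G H : sgraph) : nat :=
  let g := domination_number G in
  let h := domination_number H in
  if [|| #|G| == 1, #|H| == 1 | (g == 1) && (h == 1)] then g + h
  else if (g <= 2) || (h <= 2) then 3
  else 4.

(* Main.v *)
Require Import Defs.
From mathcomp Require Import all_boot.
From mathcomp Require Import zify.

(** Call [Z] a fort if it is nonempty and no vertex outside [Z] has exactly one
    neighbor in [Z].  The vertices that stay white form a fort, so [B] is the
    least size of a fort, and [B'] the least size of a fort with at least two
    vertices.  In [G + H] every singleton has an outside neighbor, so no fort is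
    a singleton and the two numbers agree.

    Split a fort of [G + H] into its traces [X] on [G] and [Y] on [H].  If [Y] is
    empty, [X] is a fort of [G] with [#|X| != 1], because every vertex of [H] sees
    all of [X].  If both traces are nonempty, the fort condition says exactly that
    [X] dominates [G] when [#|Y| = 1] and [Y] dominates [H] when [#|X| = 1]; the
    least size of such a pair is the constant [a]. *)

Set Implicit Arguments.
Unset Strict Implicit.
Unset Printing Implicit Defensive.

(** * Extended naturals and their finite upper bounds *)

Definition ole (x : option nat) (k : nat) : bool :=
  if x is Some a then a <= k else false.

(** Reduces an equality of minima to an equivalence, for each [k], between existence statements
    about sets of size at most [k]. *)
Lemma ole_inj x y : ole x =1 ole y -> x = y.
Proof.
case: x y => [a|] [b|] //= E.
- by congr Some; have /= := E a; have /= := E b; lia.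
- by have /= := E a; rewrite leqnn.
- by have /= := E b; rewrite leqnn.
Qed.

Lemma ole_omin x y k : ole (omin x y) k = ole x k || ole y k.
Proof. by case: x y => [a|] [b|] //=; rewrite ?orbF // geq_min. Qed.

Lemma ole_min_sizeP (T : finType) (P : pred {set T}) k :
  reflect (exists2 A, P A & #|A| <= k) (ole (min_size P) k).
Proof.
rewrite /min_size (big_morph (ole^~ k) (fun x y => ole_omin x y k) (erefl _)).
rewrite big_has_cond; apply: (iffP hasP) => [[A _ /andP[]]|[A PA leAk]].
  by exists A.
by exists A; rewrite ?mem_index_enum //= PA.
Qed.

Lemma superset_of_card (T : finType) (A : {set T}) k :
  #|A| <= k <= #|T| -> exists2 C : {set T}, A \subset C & #|C| = k.
Proof.
case/andP=> /subnKC <-; elim: (k - #|A|) => [|d IH] le_T.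
  by exists A; rewrite // addn0.
have [|C sAC cC] := IH; first lia.
have /set0Pn[x] : ~: C != set0 by rewrite -card_gt0 cardsCs setCK; lia.
rewrite inE => xC; exists (x |: C); last by rewrite cardsU1 xC; lia.
exact: subset_trans sAC (subsetUr _ _).
Qed.

(** * Forts and dominating sets in a single graph *)

Section Graph.
Variable G : sgraph.
Implicit Types (D Z : {set G}) (v : G).

Lemma mem_white_setC Z v w :
  (w \in white_neighbors (~: Z) v) = adj v w && (w \in Z).
Proof. by rewrite !inE negbK. Qed.

(** The right-hand side is the fort condition on [Z], apart from nonemptiness: the vertices outside
    [Z] are the black ones, and a force needs a unique white neighbor. *)
Lemma stalledP Z :
  reflect (forall v, v \notin Z -> #|white_neighbors (~: Z) v| != 1)
          (stalled (~: Z)).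
Proof.
apply: (iffP eqP) => [st v vZ|no1].
  apply/negP=> /cards1P[w Ew].
  have : w \in force_round (~: Z).
    rewrite inE; apply/orP; right; rewrite inE; apply/existsP; exists v.
    by rewrite inE vZ Ew eqxx.
  have : w \in white_neighbors (~: Z) v by rewrite Ew set11.
  by rewrite st mem_white_setC inE => /andP[_ ->].
apply/setUidPl/subsetP=> w; rewrite inE => /existsP[v /andP[]].
by rewrite inE => /no1 /negP no1v /eqP Ew; case: no1v; rewrite Ew cards1.
Qed.

Lemma zero_blocking_stalled Z :
  stalled (~: Z) -> zero_blocking Z = (Z != set0).
Proof.
move=> /eqP st; rewrite /zero_blocking /failed_zero_forcing /force_process.
have -> n : iter n (@force_round G) (~: Z) = ~: Z by elim: n => //= n ->.
by rewrite -setC0 (inj_eq (@setC_inj _)).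
Qed.

Lemma ole_BP k :
  reflect (exists2 Z : {set G}, stalled (~: Z) & 1 <= #|Z| <= k) (ole (B G) k).
Proof.
apply: (iffP (ole_min_sizeP _ _)) => [[Z bZ leZ]|[Z stZ /andP[Z0 leZ]]].
  (* The vertices still white at the end form a fort, nonempty because [Z] blocks. It lies inside
     [Z] since the initial black set, the case of zero rounds, is contained in the final one. *)
  exists (~: force_process (~: Z)); first by rewrite setCK force_process_stalled.
  rewrite card_gt0 -setCT (inj_eq (@setC_inj _)) [X in X && _]bZ /=.
  apply: leq_trans leZ; apply: subset_leq_card.
  by rewrite subCset (force_process_max _ 0).
by exists Z; rewrite // zero_blocking_stalled // -card_gt0.
Qed.

Lemma ole_B'P k :
  reflect (exists2 Z : {set G}, stalled (~: Z) & 2 <= #|Z| <= k) (ole (B' G) k).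
Proof.
apply: (iffP (ole_min_sizeP _ _)) => [[Z /and3P[_ st Z2] leZ]|].
  by exists Z; rewrite // Z2.
case=> Z st /andP[Z2 leZ]; exists Z => //=.
by rewrite zero_blocking_stalled // st -card_gt0 (ltnW Z2).
Qed.

Lemma dominatingT : dominating [set: G].
Proof. by apply/forallP=> v; rewrite inE. Qed.

Lemma domination_number_le D : dominating D -> domination_number G <= #|D|.
Proof.
by rewrite /domination_number; case: arg_minnP => [|D' _ min]; [exact: dominatingT|exact: min].
Qed.

Lemma domination_number_attained :
  exists2 D : {set G}, dominating D & #|D| = domination_number G.
Proof.
rewrite /domination_number; case: arg_minnP => [|D dD _]; first exact: dominatingT.
by exists D.
Qed.

Lemma dominatingS D D' : D \subset D' -> dominating D -> dominating D'.
Proof.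
move=> /subsetP sDD /forallP dD; apply/forallP=> v.
have /orP[/sDD-> //|/existsP[u /andP[uD vu]]] := dD v.
by apply/orP; right; apply/existsP; exists u; rewrite sDD.
Qed.

Lemma dominating_of_card k : domination_number G <= k <= #|G| ->
  exists2 D : {set G}, dominating D & #|D| = k.
Proof.
have [D dD <-] := domination_number_attained.
by case/superset_of_card=> D' /dominatingS/(_ dD); exists D'.
Qed.

Lemma domination_number_gt0 : 1 <= #|G| -> 1 <= domination_number G.
Proof.
have [D /forallP dD <-] := domination_number_attained => /card_gt0P[v _].
rewrite card_gt0; apply/set0Pn.
by have /orP[|/existsP[u /andP[uD _]]] := dD v; [exists v|exists u].
Qed.

Lemma domination_number_le_card : domination_number G <= #|G|.
Proof. by rewrite -cardsT domination_number_le ?dominatingT. Qed.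

(** Puts domination in terms of the same neighbor counts as the fort condition: at least one
    neighbor in [D], against not exactly one. *)
Lemma dominating_white D :
  reflect (forall v, v \notin D -> 0 < #|white_neighbors (~: D) v|)
          (dominating D).
Proof.
apply: (iffP forallP) => dD v.
  move=> vD; have := dD v; rewrite (negPf vD) /= => /existsP[u /andP[uD vu]].
  by apply/card_gt0P; exists u; rewrite mem_white_setC vu.
case: (boolP (v \in D)) => //= /dD /card_gt0P[u].
by rewrite mem_white_setC => /andP[vu uD]; apply/existsP; exists u; rewrite uD.
Qed.

End Graph.

(** * Forts of a join, through their traces *)

Section Join.
Variables G H : sgraph.
Implicit Types (X : {set G}) (Y : {set H}) (Z : {set join G H}).

Definition ltrace Z : {set G} := [set u | inl u \in Z].
Definition rtrace Z : {set H} := [set u | inr u \in Z].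
Definition join_set X Y : {set join G H} :=
  [set z | match z with inl u => u \in X | inr u => u \in Y end].

Lemma ltrace_join X Y : ltrace (join_set X Y) = X.
Proof. by apply/setP=> u; rewrite !inE. Qed.

Lemma rtrace_join X Y : rtrace (join_set X Y) = Y.
Proof. by apply/setP=> u; rewrite !inE. Qed.

Lemma card_traces Z : #|Z| = #|ltrace Z| + #|rtrace Z|.
Proof.
rewrite -!sum1_card big_sumType /=.
by congr (_ + _); apply: eq_bigl => u; rewrite inE.
Qed.

(** A vertex of [G] is adjacent in the join to all of [H], hence sees the whole right trace. *)
Lemma card_white_inl Z (u : G) :
  #|white_neighbors (~: Z) (inl u : join G H)| =
  #|white_neighbors (~: ltrace Z) u| + #|rtrace Z|.
Proof.
by rewrite card_traces; congr (_ + _); apply: eq_card => w; rewrite !inE ?negbK.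
Qed.

Lemma card_white_inr Z (u : H) :
  #|white_neighbors (~: Z) (inr u : join G H)| =
  #|ltrace Z| + #|white_neighbors (~: rtrace Z) u|.
Proof.
by rewrite card_traces; congr (_ + _); apply: eq_card => w; rewrite !inE ?negbK.
Qed.

Lemma stalled_joinP Z :
  reflect
    ((forall u, u \notin ltrace Z ->
        #|white_neighbors (~: ltrace Z) u| + #|rtrace Z| != 1) /\
     (forall u, u \notin rtrace Z ->
        #|ltrace Z| + #|white_neighbors (~: rtrace Z) u| != 1))
    (stalled (~: Z)).
Proof.
apply: (iffP (stalledP Z)) => [st|[stl str] [u|u] uZ].
- split=> u; rewrite inE => /st; first by rewrite card_white_inl.
  by rewrite card_white_inr.
- by rewrite card_white_inl stl // inE.
- by rewrite card_white_inr str // inE.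
Qed.

Lemma white_setC0 (K : sgraph) (v : K) : #|white_neighbors (~: set0) v| = 0.
Proof. by apply/eqP; rewrite cards_eq0; apply/eqP/setP=> w; rewrite !inE andbF. Qed.

Lemma stalled_join_setl X : 1 <= #|H| ->
  stalled (~: join_set X set0) = stalled (~: X) && (#|X| != 1).
Proof.
move=> /card_gt0P[y _]; apply/stalled_joinP/andP; rewrite ltrace_join rtrace_join cards0.
  case=> stX /(_ y); rewrite inE white_setC0 addn0 => -> //; split=> //.
  by apply/stalledP=> v /stX; rewrite addn0.
case=> /stalledP stX X1; split=> v; first by rewrite addn0; apply: stX.
by rewrite white_setC0 addn0.
Qed.

Lemma stalled_join_setr Y : 1 <= #|G| ->
  stalled (~: join_set set0 Y) = stalled (~: Y) && (#|Y| != 1).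
Proof.
move=> /card_gt0P[x _]; apply/stalled_joinP/andP; rewrite ltrace_join rtrace_join cards0.
  case=> /(_ x); rewrite inE white_setC0 => Y1 stY; rewrite Y1 //; split=> //.
  by apply/stalledP=> v /stY.
case=> /stalledP stY Y1; split=> v; last exact: stY.
by rewrite white_setC0.
Qed.

(** A vertex of [G] outside [X] sees all of [Y]. If [Y] has two or more vertices its count cannot be
    1; if [Y] is a singleton, the count differs from 1 exactly when the vertex has a neighbor in
    [X]. The other side is symmetric. *)
Lemma stalled_join_set X Y : 1 <= #|X| -> 1 <= #|Y| ->
  stalled (~: join_set X Y) =
  ((#|Y| == 1) ==> dominating X) && ((#|X| == 1) ==> dominating Y).
Proof.
move=> X0 Y0; apply/stalled_joinP/andP; rewrite ltrace_join rtrace_join => -[c1 c2].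
  by split; apply/implyP=> /eqP E; apply/dominating_white=> v;
    [move/c1|move/c2]; rewrite E; lia.
split=> v vN.
  case: (#|Y| =P 1) c1 => [-> /dominating_white/(_ v vN)|]; lia.
case: (#|X| =P 1) c2 => [-> /dominating_white/(_ v vN)|]; lia.
Qed.

Lemma join_set_traces Z : join_set (ltrace Z) (rtrace Z) = Z.
Proof. by apply/setP=> -[u|u]; rewrite !inE. Qed.

Lemma card_join_set X Y : #|join_set X Y| = #|X| + #|Y|.
Proof. by rewrite card_traces ltrace_join rtrace_join. Qed.

Hypotheses (hG : 1 <= #|G|) (hH : 1 <= #|H|).

Lemma stalled_join_card_neq1 Z : stalled (~: Z) -> #|Z| != 1.
Proof.
rewrite -(join_set_traces Z) card_join_set.
case: (set_0Vmem (ltrace Z)) => [->|[x xZ]].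
  by rewrite stalled_join_setr // cards0 => /andP[].
case: (set_0Vmem (rtrace Z)) => [->|[y yZ]].
  by rewrite stalled_join_setl // cards0 addn0 => /andP[].
have : 0 < #|ltrace Z| by apply/card_gt0P; exists x.
have : 0 < #|rtrace Z| by apply/card_gt0P; exists y.
lia.
Qed.

Lemma join_constant_le X Y :
  1 <= #|X| -> 1 <= #|Y| -> stalled (~: join_set X Y) ->
  join_constant G H <= #|X| + #|Y|.
Proof.
move=> X0 Y0; rewrite stalled_join_set // => /andP[dX dY].
have gX : #|Y| = 1 -> domination_number G <= #|X|.
  by move=> Y1; rewrite Y1 in dX; exact: domination_number_le.
have hY : #|X| = 1 -> domination_number H <= #|Y|.
  by move=> X1; rewrite X1 in dY; exact: domination_number_le.
have Xn : #|X| <= #|G| := max_card _; have Ym : #|Y| <= #|H| := max_card _.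
have := domination_number_gt0 hG; have := domination_number_gt0 hH.
have := domination_number_le_card G; have := domination_number_le_card H.
(* If [#|G|] or [#|H|] is 1, that trace is a single vertex and the other trace dominates. Otherwise,
   a total of 2 makes both domination numbers 1, and a total of 3 pairs a singleton with a
   dominating set of size 2. *)
rewrite /join_constant; case: ifP; [lia|case: ifP; lia].
Qed.

Lemma join_constant_attained :
  exists (X : {set G}) (Y : {set H}), [/\ 1 <= #|X|, 1 <= #|Y|, stalled (~: join_set X Y)
                & #|X| + #|Y| = join_constant G H].
Proof.
have g0 := domination_number_gt0 hG; have h0 := domination_number_gt0 hH.
have gn := domination_number_le_card G; have hm := domination_number_le_card H.
rewrite /join_constant; case: ifPn => [_|]; last rewrite !negb_or => /and3P[n1 m1 _].
  have [X dX cX] := domination_number_attained G.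
  have [Y dY cY] := domination_number_attained H.
  (* Minimum dominating sets on both sides meet the two conditions of [stalled_join_set] whatever
     their sizes. *)
  exists X, Y; split; rewrite ?cX ?cY //.
  by rewrite stalled_join_set ?cX ?cY // dX dY !implybT.
have sets (K : sgraph) k : k <= #|K| -> exists X : {set K}, #|X| = k.
  by move=> le_k; have [|X] := @superset_of_card _ (set0 : {set K}) k;
    [rewrite cards0|exists X].
case: ifPn => [/orP[g2|h2]|].
(* A dominating pair in [G] allows any single vertex of [H]: since [#|X|] is 2, nothing is asked of
   [Y]. *)
- have [|X dX cX] := @dominating_of_card G 2; first lia.
  have [Y cY] := sets H 1 hH.
  exists X, Y; split; rewrite ?cX ?cY //.
  by rewrite stalled_join_set ?cX ?cY // dX.
- have [|Y dY cY] := @dominating_of_card H 2; first lia.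
  have [X cX] := sets G 1 hG.
  exists X, Y; split; rewrite ?cX ?cY //.
  by rewrite stalled_join_set ?cX ?cY // dY.
(* With two vertices on each side neither implication of [stalled_join_set] applies, so arbitrary
   pairs work. *)
- move=> _; have [|X cX] := sets G 2; first lia.
  have [|Y cY] := sets H 2; first lia.
  exists X, Y; split; rewrite ?cX ?cY //.
  by rewrite stalled_join_set ?cX ?cY.
Qed.

Lemma B'_join : B' (join G H) = B (join G H).
Proof.
apply: ole_inj => k; apply/ole_B'P/ole_BP => -[Z st cZ]; exists Z => //; first lia.
have := stalled_join_card_neq1 st; lia.
Qed.

Lemma B_join :
  B (join G H) = omin (B' G) (omin (B' H) (Some (join_constant G H))).
Proof.
apply: ole_inj => k; rewrite !ole_omin /=; apply/ole_BP/or3P.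
  case=> Z st cZ; have Z1 := stalled_join_card_neq1 st.
  move: st cZ Z1; rewrite -(join_set_traces Z) card_join_set.
  move: (ltrace Z) (rtrace Z) => X Y.
  (* A fort inside one side must avoid size 1, which is why [B'] and not [B] of that side enters the
     minimum. *)
  have [->|X0] := eqVneq X set0.
    rewrite stalled_join_setr // cards0 => /andP[st _] cY Y1.
    by constructor 2; apply/ole_B'P; exists Y; lia.
  have [->|Y0] := eqVneq Y set0.
    rewrite stalled_join_setl // cards0 => /andP[st _] cX X1.
    by constructor 1; apply/ole_B'P; exists X; lia.
  move=> /join_constant_le; rewrite !card_gt0 X0 Y0 => /(_ isT isT) le_a cXY _.
  by constructor 3; lia.
case=> [/ole_B'P[X st cX]|/ole_B'P[Y st cY]|].
- exists (join_set X set0); first by rewrite stalled_join_setl // st; lia.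
  by rewrite card_join_set cards0; lia.
- exists (join_set set0 Y); first by rewrite stalled_join_setr // st; lia.
  by rewrite card_join_set cards0; lia.
have [X [Y [X0 Y0 st <-]]] := join_constant_attained => le_k.
by exists (join_set X Y); rewrite // card_join_set; lia.
Qed.

End Join.

Theorem theorem4 (G H : sgraph) (hG : 1 <= #|G|) (hH : 1 <= #|H|) :
  B' (join G H) = B (join G H) /\
  B (join G H) = omin (B' G) (omin (B' H) (Some (join_constant G H))).
Proof. by split; [exact: B'_join|exact: B_join]. Qed.
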